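(* Let $\mathcal{C}$ be a $d$-clutter such that the simplicial complex $\langle \mathcal{C}^\vee\rangle$ is vertex decomposable. Then $\mathcal{C}$ is chordal.
   Context: A clutter $\mathcal{C}$ on a finite vertex set $V=V(\mathcal{C})$ is a family of subsets of $V$, called circuits, that are pairwise incomparable under inclusion. For $F\subseteq V$ put $\dim F=|F|-1$. A $d$-clutter is a clutter all of whose circuits have dimension $d$ (i.e. $d+1$ elements). The complement $\overline{\mathcal{C}}$ of a $d$-clutter $\mathcal{C}$ is the $d$-clutter on $V$ with circuits $\{F\subseteq V: \dim F=d,\ F\notin\mathcal{C}\}$, and $\mathcal{C}^\vee=\{V\setminus F: F\in\overline{\mathcal{C}}\}$. Chordality. A subset $A\subseteq V$ is a clique of $\mathcal{C}$ if all $(d+1)$-element subsets of $A$ belong to $\mathcal{C}$ (so sets with at most $d$ elements are cliques). $\mathcal{MS}(\mathcal{C})$ is the set of maximal subcircuits of $\mathcal{C}$: the $d$-element subsets $e\subseteq V$ contained in some circuit. $N_{\mathcal{C}}[e]=e\cup\{v\in V: e\cup\{v\}\in\mathcal{C}\}$. A maximal subcircuit $e$ is simplicial if $N_{\mathcal{C}}[e]$ is a clique; $\mathcal{SMS}(\mathcal{C})$ is the set of simplicial maximal subcircuits. $\mathcal{C}-e$ is the clutter on $V$ with circuits $\{F\in\mathcal{C}: e\not\subseteq F\}$. $\mathcal{C}$ is chordal if there is a (possibly empty) sequence $e_1,\dots,e_t$ with $e_i\in\mathcal{SMS}(\mathcal{C}_{i-1})$ for $1\le i\le t$, where $\mathcal{C}_0=\mathcal{C}$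 and $\mathcal{C}_i=\mathcal{C}_{i-1}-e_i$, such that $\mathcal{C}_t$ has no circuits. Simplicial complexes. A simplicial complex $\Delta$ on a vertex set $V(\Delta)$ is a family of subsets of $V(\Delta)$ closed under taking subsets; its members are faces and the maximal faces are facets. For a clutter $\mathcal{D}$, $\langle\mathcal{D}\rangle$ is the simplicial complex on $V(\mathcal{D})$ whose set of facets is $\mathcal{D}$. A simplex is a simplicial complex with exactly one facet. For $v\in V(\Delta)$: $\mathrm{link}_\Delta v=\{G\setminus\{v\}: v\in G\in\Delta\}$ and $\Delta-v=\{F\in\Delta: v\notin F\}$, both on the vertex set $V(\Delta)\setminus\{v\}$. A vertex $v$ of a nonempty simplicial complex $\Delta$ is a shedding vertex if no face of $\mathrm{link}_\Delta v$ is a facet of $\Delta-v$. A nonempty simplicial complex $\Delta$ is vertex decomposable if either it is a simplex or there is a shedding vertex $v\in V(\Delta)$ such that both $\mathrm{link}_\Delta v$ and $\Delta-v$ are vertex decomposable. *)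

(* Defs.v *)
From mathcomp Require Import all_boot.

Set Implicit Arguments.
Unset Strict Implicit.
Unset Printing Implicit Defensive.

(* A family of subsets of a finite vertex set is a [{set {set T}}], its vertex
   set [V : {set T}] being carried separately: a vertex need not lie in any
   member of the family, and links and deletions shrink the vertex set. *)

Section Clutters.

Variable T : finType.
Implicit Types (V A F G e : {set T}) (C : {set {set T}}) (d : nat).

Definition clutter V C : Prop :=
  {in C, forall F, F \subset V} /\ {in C &, forall F G, F \subset G -> F = G}.

Definition d_clutter d V C : Prop :=
  clutter V C /\ {in C, forall F, #|F| = d.+1}.

(* [d] is an argument because it cannot be recovered from [C] when [C] has no
   circuits. *)
Definition complement d V C : {set {set T}} :=
  [set F : {set T} | [&& F \subset V, #|F| == d.+1 & F \notin C]].

Definition clutter_dual d V C : {set {set T}} :=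
  [set V :\: F | F in complement d V C].

Definition clique d V C A : bool :=
  (A \subset V) &&
  [forall F : {set T}, (F \subset A) && (#|F| == d.+1) ==> (F \in C)].

Definition max_subcircuits d V C : {set {set T}} :=
  [set e : {set T} |
    [&& e \subset V, #|e| == d & [exists F in C, e \subset F]]].

Definition closed_nbhd V C e : {set T} := e :|: [set v in V | v |: e \in C].

Definition simplicial_max_subcircuits d V C : {set {set T}} :=
  [set e in max_subcircuits d V C | clique d V C (closed_nbhd V C e)].

Definition clutter_del C e : {set {set T}} :=
  [set F in C | ~~ (e \subset F)].

Fixpoint simplicial_order d V C (es : seq {set T}) : bool :=
  if es is e :: es' then
    (e \in simplicial_max_subcircuits d V C) &&
      simplicial_order d V (clutter_del C e) es'
  else C == set0.

Definition chordal d V C : Prop :=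
  exists es : seq {set T}, simplicial_order d V C es.

End Clutters.

Section Complexes.

Variable T : finType.
Implicit Types (V F G : {set T}) (D K : {set {set T}}) (v : T).

(* The family may be empty; [set0] (no faces) differs from [[set set0]]. *)
Definition simplicial_complex V K : Prop :=
  {in K, forall F, F \subset V} /\
  (forall F G, G \in K -> F \subset G -> F \in K).

Definition facets K : {set {set T}} := [set F | maxset (fun G => G \in K) F].

Definition generated_complex D : {set {set T}} :=
  [set F : {set T} | [exists G in D, F \subset G]].

Definition simplex K : bool := #|facets K| == 1.

Definition link K v : {set {set T}} := [set G :\ v | G in K & v \in G].

Definition deletion K v : {set {set T}} := [set F in K | v \notin F].

Definition shedding_vertex V K v : Prop :=
  v \in V /\ {in link K v, forall F, F \notin facets (deletion K v)}.

Inductive vertex_decomposable V K : Prop :=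
| VD_simplex of simplicial_complex V K & K != set0 & simplex K
| VD_shed v of simplicial_complex V K & K != set0 & shedding_vertex V K v &
    vertex_decomposable (V :\ v) (link K v) &
    vertex_decomposable (V :\ v) (deletion K v).

(* The next three lemmas show that the premises [simplicial_complex] above
   exclude nothing once [K] is generated by subsets of [V]. *)
Lemma generated_simplicial_complex V D :
  {in D, forall F, F \subset V} -> simplicial_complex V (generated_complex D).
Proof.
move=> DV; split=> [F | F G].
  rewrite inE => /existsP[G /andP[GD FG]]; exact: subset_trans FG (DV _ GD).
rewrite !inE => /existsP[H /andP[HD GH]] FG; apply/existsP; exists H.
by rewrite HD (subset_trans FG GH).
Qed.

Lemma link_simplicial_complex V K v :
  simplicial_complex V K -> simplicial_complex (V :\ v) (link K v).
Proof.
move=> [KV Kcl]; split=> [F /imsetP[G /[!inE] /andP[GK _] ->] | F G].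
  exact: setSD (KV _ GK).
move=> /imsetP[H /[!inE] /andP[HK vH] ->]; rewrite subsetD1 => /andP[FH vF].
apply/imsetP; exists (v |: F); last by rewrite setU1K.
rewrite inE; apply/andP; split; last exact: setU11.
by apply: Kcl HK _; rewrite subUset sub1set FH andbT.
Qed.

Lemma deletion_simplicial_complex V K v :
  simplicial_complex V K -> simplicial_complex (V :\ v) (deletion K v).
Proof.
move=> [KV Kcl]; split=> [F | F G]; rewrite !inE => /andP[FK vF].
  by rewrite subsetD1 KV.
by move=> FG; rewrite (Kcl _ _ FK FG) (contra (subsetP FG v) vF).
Qed.

Lemma facets_generated_complex V D :
  clutter V D -> facets (generated_complex D) = D.
Proof.
have genP F : reflect (exists2 G, G \in D & F \subset G)
                      (F \in generated_complex D).
  by rewrite inE; exact: exists_inP.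
move=> [_ anti]; apply/setP=> F; rewrite inE; apply/maxsetP/idP.
  move=> [/genP[G GD FG] mx]; rewrite -(mx G _ FG) //.
  by apply/genP; exists G.
move=> FD; split=> [|G /genP[H HD GH] FG]; first by apply/genP; exists F.
have FH := anti _ _ FD HD (subset_trans FG GH).
by apply/eqP; rewrite eqEsubset FG {1}FH GH.
Qed.

End Complexes.

(* Main.v *)
Require Import Defs.
From mathcomp Require Import all_boot.

(** Let K be the complex generated by the dual of C: its faces are the sets
    whose complement in V contains a non-circuit of cardinality d+1, so K is
    the Alexander dual of the clique complex of C.  Duality turns the recursion
    of vertex decomposability into a recursion on clutters.
    - The link in K of a vertex v is the dual complex of the circuits avoiding v
      ([link_dual_complex]).
    - When v is shedding, the deletion of v from K is the dual complex of the
      link of v in C, whose circuits are one element smaller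
      ([deletion_dual_complex]).
    - Read on C, the shedding condition says that a (d+1)-set avoiding v which
      is a clique of the link of v in C must be a circuit of C
      ([shedding_circuit]).
    Under this last condition, chordality of the link and of the deletion of v
    in C gives chordality of C ([chordal_shed]): adding v to each member of an
    elimination order of the link gives an elimination order that removes from C
    exactly the circuits through v, and the order of the deletion finishes the
    job.  If K is a simplex, then C misses exactly one (d+1)-set, and the
    same gluing lemma, used at a vertex of the missing set, shows that C is
    chordal ([chordal_at_most_one_missing]).  The recursion stops at d = 0,
    where removing the empty set eliminates all circuits at once
    ([chordal_dim0]).

    The operations [link] and [deletion] make sense for any family of sets, so
    they serve both for complexes and for clutters. *)

Set Implicit Arguments.
Unset Strict Implicit.
Unset Printing Implicit Defensive.

Section VertexDecomposableDual.

Variable T : finType.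
Implicit Types (V W F G H e f : {set T}) (C K : {set {set T}}).
Implicit Types (d : nat) (v : T).

(** * Links and deletions of uniform families *)

Definition uniform d V C : Prop :=
  {in C, forall F, F \subset V /\ #|F| = d.+1}.

Lemma in_link K v F : (F \in link K v) = (v \notin F) && (v |: F \in K).
Proof.
apply/imsetP/andP => [[G /[!inE] /andP[GK vG] ->] | [vF FK]].
  by rewrite setD11 setD1K.
by exists (v |: F); rewrite ?setU1K // inE FK setU11.
Qed.

Lemma uniform_link d V C v :
  uniform d.+1 V C -> uniform d (V :\ v) (link C v).
Proof.
move=> CV F; rewrite in_link => /andP[vF /CV[]].
rewrite subUset cardsU1 vF => /andP[_ FV] [cF].
by rewrite subsetD1 FV vF.
Qed.

Lemma uniform_deletion d V C v :
  uniform d V C -> uniform d (V :\ v) (deletion C v).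
Proof.
by move=> CV F; rewrite inE => /andP[/CV[FV cF] vF]; rewrite subsetD1 FV vF.
Qed.

Lemma uniform_clutter_del d V C e :
  uniform d V C -> uniform d V (clutter_del C e).
Proof. by move=> CV F; rewrite inE => /andP[/CV]. Qed.

Lemma clutter_del_link C v e :
  v \notin e -> clutter_del (link C v) e = link (clutter_del C (v |: e)) v.
Proof.
move=> ve; apply/setP=> F; rewrite inE !in_link inE -andbA.
case vF: (v \in F) => //=; congr (_ && ~~ _).
have {1}<- : e :\ v = e by apply/setDidPl; rewrite disjoint_sym disjoints1.
by rewrite subDset subUset sub1set setU11.
Qed.

Lemma deletion_clutter_del C v e :
  deletion (clutter_del C (v |: e)) v = deletion C v.
Proof.
apply/setP=> F; rewrite !inE; case: (F \in C) => //=.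
case vF: (v \in F); first by rewrite andbF.
by rewrite subUset sub1set vF.
Qed.

(** * Building elimination orders *)

(** A vertex lying in no circuit can only belong to the closed neighbourhood of
    [e] as an element of [e], so the new vertices change no neighbourhood. *)
Lemma simplicial_order_widen d V W C es :
  V \subset W -> uniform d V C ->
  simplicial_order d V C es -> simplicial_order d W C es.
Proof.
move=> VW; elim: es C => //= e es IH C CV /andP[eS ord].
rewrite IH ?andbT //; last exact: uniform_clutter_del.
move: eS; rewrite !inE => /andP[/and3P[eV -> ->] eC].
rewrite (subset_trans eV VW) /=.
have -> : closed_nbhd W C e = closed_nbhd V C e.
  apply/setP=> x; rewrite !inE; congr (_ || _).
  case xC: (x |: e \in C); rewrite ?andbF ?andbT //.
  have [] := CV _ xC; rewrite subUset sub1set => /andP[xV _] _.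
  by rewrite xV (subsetP VW).
by case/andP: eC => NV cl; rewrite /clique (subset_trans NV VW).
Qed.

(** The neighbourhood of [v |: e] is [v] added to the neighbourhood of [e] in
    the link.  A test set through [v] is a circuit since the latter is a clique
    of the link; a test set avoiding [v] is one by the last hypothesis. *)
Lemma simplicial_link d V C v e :
  v \in V -> uniform d.+1 V C ->
  (forall F, F \subset V :\ v -> #|F| = d.+2 ->
     (forall f, f \subset F -> #|f| = d.+1 -> v |: f \in C) -> F \in C) ->
  e \in simplicial_max_subcircuits d (V :\ v) (link C v) ->
  v |: e \in simplicial_max_subcircuits d.+1 V C.
Proof.
move=> vV CV shed; rewrite !inE => /andP[/and3P[eV /eqP ce /exists_inP[G GC eG]]].
case/andP=> NV /forall_inP cl.
move: eV; rewrite subsetD1 => /andP[eV ve].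
move: GC; rewrite in_link => /andP[vG GC].
rewrite subUset sub1set vV eV cardsU1 ve ce eqxx /=.
apply/andP; split.
  by apply/exists_inP; exists (v |: G) => //; apply: setUS.
set N := closed_nbhd (V :\ v) (link C v) e in NV cl.
have clN f : f \subset N -> #|f| = d.+1 -> v |: f \in C.
  move=> fN cf; have := cl f; rewrite fN cf eqxx in_link => /(_ isT).
  by case/andP.
have subN : closed_nbhd V C (v |: e) \subset v |: N.
  apply/subsetP=> x; rewrite !inE in_link !inE.
  case: (altP (x =P v)) => [->//|xv] /=.
  case xe: (x \in e) => //= /andP[xV xC].
  by rewrite xV eq_sym (negPf xv) (negPf ve) setUCA xC.
rewrite /clique (subset_trans subN) /=; last first.
  by rewrite subUset sub1set vV (subset_trans NV (subD1set _ _)).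
apply/forall_inP=> F /andP[/subset_trans/(_ subN) FN /eqP cF].
have FN' : F :\ v \subset N by rewrite subDset.
case vF: (v \in F).
  rewrite -(setD1K vF); apply: clN => //.
  by move: cF; rewrite (cardsD1 v) vF => -[].
move: FN'; rewrite (setDidPl _) ?disjoints1 1?disjoint_sym ?disjoints1 ?vF //.
move=> FN'; apply: shed => // [|f fF]; first exact: subset_trans NV.
exact/clN/(subset_trans fF).
Qed.

(** Eliminating [v |: e] instead of [e] shrinks the link of [v] as prescribed
    and leaves the circuits avoiding [v] untouched; the third hypothesis only
    becomes weaker when the link shrinks, so the argument can be iterated. *)
Lemma chordal_shed d V C v :
  v \in V -> uniform d.+1 V C ->
  (forall F, F \subset V :\ v -> #|F| = d.+2 ->
     (forall f, f \subset F -> #|f| = d.+1 -> v |: f \in C) -> F \in C) ->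
  chordal d (V :\ v) (link C v) ->
  chordal d.+1 (V :\ v) (deletion C v) ->
  chordal d.+1 V C.
Proof.
move=> vV CV shed [es ord] chD.
elim: es C CV shed ord chD => [|e es IH] C CV shed /=.
  move/eqP=> lk0 [es ord]; exists es.
  have dC : deletion C v = C.
    apply/setP=> F; rewrite inE; case FC: (F \in C) => //=.
    apply/negP=> vF; have : F :\ v \in link C v by rewrite in_link setD11 setD1K.
    by rewrite lk0 inE.
  rewrite dC in ord; apply: simplicial_order_widen ord; first exact: subD1set.
  by rewrite -dC; apply: uniform_deletion.
case/andP=> eS; have ve : v \notin e.
  by move: eS; rewrite !inE => /andP[/and3P[]]; rewrite subsetD1 => /andP[].
rewrite clutter_del_link // => ord chD.
have [|F FV cF Fcl||es' ord'] := IH (clutter_del C (v |: e)) _ _ ord.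
- exact: uniform_clutter_del.
- rewrite inE shed //=; last by move=> f /Fcl/[apply]; rewrite inE => /andP[].
  by move: FV; rewrite subUset sub1set subsetD1 => /andP[_ /negPf->].
- by rewrite deletion_clutter_del.
exists (v |: e :: es') => /=; rewrite ord' andbT.
exact: simplicial_link.
Qed.

(** When there are circuits, the empty set is simplicial, since every vertex of
    its neighbourhood is a circuit, and removing it removes every circuit. *)
Lemma chordal_dim0 V C : uniform 0 V C -> chordal 0 V C.
Proof.
move=> CV; have [->|[F FC]] := set_0Vmem C; first by exists [::] => /=.
exists [:: set0] => /=; apply/andP; split; last first.
  by apply/eqP/setP=> G; rewrite !inE sub0set andbF.
rewrite !inE sub0set cards0 eqxx /=; apply/andP; split.
  by apply/exists_inP; exists F; rewrite ?sub0set.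
rewrite /clique /closed_nbhd set0U; apply/andP; split.
  by apply/subsetP=> x; rewrite inE => /andP[].
apply/forall_inP=> G /andP[GN /cards1P[x Gx]]; move: GN.
by rewrite {}Gx sub1set inE setU0 => /andP[].
Qed.

(** The induction vertex is taken in the missing set if there is one: then no
    set avoiding it is missing, so the gluing condition holds trivially, and
    the link and the deletion again miss at most one set. *)
Lemma chordal_at_most_one_missing d V C :
  uniform d V C -> {in complement d V C &, forall F G, F = G} ->
  chordal d V C.
Proof.
have [n] := ubnP #|V|; elim: n d V C => // n IH [|d] V C ltn CV miss1.
  exact: chordal_dim0.
have [V0|[v0 v0V]] := set_0Vmem V.
  exists [::] => /=; apply/eqP/setP=> F; rewrite inE; apply/negP=> /CV[].
  by rewrite V0 subset0 => /eqP->; rewrite cards0.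
have [v vV vmiss] : exists2 v, v \in V & {in complement d.+1 V C, forall F, v \in F}.
  have [C0|[F FC]] := set_0Vmem (complement d.+1 V C).
    by exists v0 => // F; rewrite C0 inE.
  have /card_gt0P[v vF] : 0 < #|F| by case/setIdP: FC => _ /andP[/eqP-> _].
  exists v; first by case/setIdP: FC => /subsetP/(_ v vF).
  by move=> G GC; rewrite (miss1 G F).
have ltn' : #|V :\ v| < n by move: ltn; rewrite (cardsD1 v V) vV.
have noneD F : F \subset V :\ v -> #|F| = d.+2 -> F \in C.
  rewrite subsetD1 => /andP[FV vF] cF; apply: contraNT vF => FC.
  by apply: vmiss; rewrite inE FV cF eqxx.
apply: (chordal_shed vV CV) => [F FV cF _||]; first exact: noneD.
  apply: IH => //; first exact: uniform_link.
  have missU F : F \in complement d (V :\ v) (link C v) ->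
      v \notin F /\ v |: F \in complement d.+1 V C.
    rewrite !inE in_link subsetD1 => /and3P[/andP[FV vF] /eqP cF].
    by rewrite vF subUset sub1set vV FV cardsU1 vF cF eqxx.
  move=> F G /missU[vF FC] /missU[vG GC].
  by rewrite -(setU1K vF) (miss1 _ _ FC GC) setU1K.
apply: IH => //; first exact: uniform_deletion.
move=> F G; rewrite !inE => /and3P[FV /eqP cF].
by rewrite (noneD F) //=; move: FV; rewrite subsetD1 => /andP[_ ->].
Qed.

(** * Alexander duality between complexes and clutters *)

Local Notation dual_complex d V C := (generated_complex (clutter_dual d V C)).

Lemma dual_complexP d V C F :
  reflect (F \subset V /\
           exists H, [/\ H \subset V :\: F, #|H| = d.+1 & H \notin C])
          (F \in dual_complex d V C).
Proof.
rewrite inE; apply: (iffP exists_inP).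
  move=> [_ /imsetP[H /[!inE] /and3P[HV /eqP cH HC] ->]].
  rewrite subsetD => /andP[FV FH]; split=> //; exists H; split=> //.
  by rewrite subsetD HV disjoint_sym.
move=> [FV [H [HVF cH HC]]]; move: HVF; rewrite subsetD => /andP[HV HF].
exists (V :\: H); last by rewrite subsetD FV disjoint_sym.
by apply/imsetP; exists H; rewrite // inE HV cH eqxx.
Qed.

Lemma link_dual_complex d V C v :
  v \in V -> link (dual_complex d V C) v = dual_complex d (V :\ v) (deletion C v).
Proof.
move=> vV; apply/setP=> F; rewrite in_link.
have VE : V :\: (v |: F) = V :\ v :\: F by rewrite setDDl.
apply/andP/dual_complexP => [[vF /dual_complexP[FV [H [HV cH HC]]]] | [FV [H [HV cH HC]]]].
  move: FV; rewrite subUset subsetD1 vF => /andP[_ ->]; split=> //.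
  by exists H; rewrite -VE HV inE (negPf HC).
move: FV; rewrite subsetD1 => /andP[FV vF]; split=> //.
apply/dual_complexP; rewrite subUset sub1set vV FV VE; split=> //.
exists H; split=> //; apply: contra HC => HC; rewrite inE HC.
by move: HV; rewrite subsetD subsetD1 => /andP[/andP[]].
Qed.

(** If [F] were not a circuit, its complement in [V :\ v] would be a face of
    the link, hence not a facet of the deletion; a larger face of the deletion
    is the complement of a proper subset of [F] together with [v], and by
    cardinality this complement is itself a non-circuit [v |: f]. *)
Lemma shedding_circuit d V C v :
  shedding_vertex V (dual_complex d.+1 V C) v ->
  forall F, F \subset V :\ v -> #|F| = d.+2 ->
    (forall f, f \subset F -> #|f| = d.+1 -> v |: f \in C) -> F \in C.
Proof.
move=> [vV shed] F FV cF Fcl; apply: contraT => FC.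
move: FV; rewrite subsetD1 => /andP[FV vF].
set G := V :\ v :\: F.
have vG : v \notin G by rewrite !inE eqxx andbF.
have GV : G \subset V by rewrite /G setDDl subsetDl.
have FVG : F \subset V :\: (v |: G).
  apply/subsetP=> x xF; rewrite !inE xF (subsetP FV) //= andbT.
  by rewrite orbF; apply: contraNneq vF => <-.
have lkG : G \in link (dual_complex d.+1 V C) v.
  rewrite in_link vG; apply/dual_complexP; split.
    by rewrite subUset sub1set vV.
  by exists F.
have delG : G \in deletion (dual_complex d.+1 V C) v.
  rewrite inE vG andbT; apply/dual_complexP; split=> //.
  by exists F; split=> //; apply: subset_trans FVG _; rewrite setDS // subsetUr.
have := shed G lkG; rewrite inE => /negP[]; apply/maxsetP; split=> // G'.
rewrite inE => /andP[/dual_complexP[G'V [H [HV cH HC]]] vG'] GG'.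
have HvF : H \subset v |: F.
  apply: subset_trans HV _; apply/subsetP=> x; rewrite !inE => /andP[xG' xV].
  have := contra (subsetP GG' x) xG'; rewrite !inE xV.
  by rewrite andbT negb_and !negbK orbC.
case vH: (v \in H).
  case/negP: HC; rewrite -(setD1K vH); apply: Fcl; first by rewrite subDset.
  by move: cH; rewrite (cardsD1 v) vH => -[].
(* A non-circuit avoiding [v] fills [F], so that [G'] is no larger than [G]. *)
have HF : H = F.
  apply/eqP; rewrite eqEcard cH cF leqnn andbT; apply/subsetP=> x xH.
  have := subsetP HvF x xH; rewrite !inE => /predU1P[xv|//].
  by rewrite -xv xH in vH.
apply/eqP; rewrite eqEsubset GG' andbT subsetD subsetD1 G'V vG' /=.
by move: HV; rewrite HF subsetD disjoint_sym => /andP[].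
Qed.

Lemma deletion_dual_complex d V C v :
  shedding_vertex V (dual_complex d.+1 V C) v ->
  deletion (dual_complex d.+1 V C) v = dual_complex d (V :\ v) (link C v).
Proof.
move=> shed; have [vV _] := shed; have circ := shedding_circuit shed.
apply/setP=> F; rewrite inE.
apply/andP/dual_complexP => [[/dual_complexP[FV [H [HV cH HC]]] vF] | [FV [h [hV ch hC]]]].
  rewrite subsetD1 FV vF; split=> //.
  have [HV' HF] : H \subset V /\ [disjoint H & F].
    by apply/andP; rewrite -subsetD.
  have [f [fH vf cf fC]] : exists f, [/\ f \subset H, v \notin f, #|f| = d.+1
                                      & v |: f \notin C].
    case vH: (v \in H).
      exists (H :\ v); rewrite subD1set setD11 setD1K //; split=> //.
      by move: cH; rewrite (cardsD1 v) vH => -[].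
    have /existsP[f /and3P[fH /eqP cf fC]] :
        [exists f : {set T}, [&& f \subset H, #|f| == d.+1 & v |: f \notin C]].
      apply: contraNT HC => /existsPn nf; apply: circ => //.
        by rewrite subsetD1 HV' vH.
      by move=> f fH cf; have := nf f; rewrite fH cf eqxx /= negbK.
    by exists f; split=> //; apply: contraFN vH; apply: (subsetP fH).
  exists f; rewrite in_link (negPf fC) andbF subsetD subsetD1 vf.
  by rewrite (subset_trans fH HV') (disjointWl fH HF).
move: FV; rewrite subsetD1 => /andP[FV vF].
move: hV; rewrite subsetD subsetD1 => /andP[/andP[hV vh] hF].
split=> //; apply/dual_complexP; split=> //; exists (v |: h); split.
- by rewrite subUset sub1set inE vF vV subsetD hV.
- by rewrite cardsU1 vh ch.
- by move: hC; rewrite in_link vh.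
Qed.

Lemma clutter_clutter_dual d V C : clutter V (clutter_dual d V C).
Proof.
split=> [_ /imsetP[F _ ->]|]; first exact: subsetDl.
move=> _ _ /imsetP[F /[!inE] /and3P[FV /eqP cF _] ->]
  /imsetP[G /[!inE] /and3P[GV /eqP cG _] ->] sub.
by apply/eqP; rewrite eqEcard sub !cardsDS // cF cG leqnn.
Qed.

Lemma chordal_dual_simplex d V C :
  uniform d V C -> simplex (dual_complex d V C) -> chordal d V C.
Proof.
move=> CV; rewrite /simplex (facets_generated_complex (clutter_clutter_dual _ _ _)).
move=> /cards1P[E dE]; apply: chordal_at_most_one_missing => // F G FC GC.
have compE H : H \in complement d V C -> H = V :\: E.
  move=> HC; have : V :\: H \in clutter_dual d V C by apply: imset_f.
  rewrite dE inE => /eqP<-; rewrite setDDr setDv set0U; apply/esym/setIidPr.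
  by case/setIdP: HC.
by rewrite (compE F FC) (compE G GC).
Qed.

Lemma vertex_decomposable_dual_chordal d V C :
  uniform d V C -> vertex_decomposable V (dual_complex d V C) -> chordal d V C.
Proof.
move=> CV vd; move KE: (dual_complex d V C) vd => K vd.
elim: vd d C CV KE => {V K} [V K _ _ Ks|V K v _ _ shed _ IHl _ IHd] d C CV KE.
  by apply: chordal_dual_simplex; rewrite ?KE.
case: d CV KE => [|d] CV KE; first exact: chordal_dim0.
rewrite -KE in shed IHl IHd; have [vV _] := shed.
apply: (chordal_shed vV CV (shedding_circuit shed)).
  by apply: IHd; [apply: uniform_link | rewrite deletion_dual_complex].
by apply: IHl; [apply: uniform_deletion | rewrite link_dual_complex].
Qed.

End VertexDecomposableDual.

Theorem theorem3p10 (T : finType) (V : {set T}) (d : nat) (C : {set {set T}}) :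
  d_clutter d V C ->
  vertex_decomposable V (generated_complex (clutter_dual d V C)) ->
  chordal d V C.
Proof.
move=> [[CV _] cC]; apply: vertex_decomposable_dual_chordal => F FC.
by split; [apply: CV | apply: cC].
Qed.
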